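(* Let $\{\Theta_\omega\}_{\omega\in\Omega}$ be a $cg$-orthonormal basis for $H$ with respect to $\{H_\omega\}_{\omega\in\Omega}$, and let $\{\Lambda_\omega\in B(H,H_\omega):\omega\in\Omega\}$ be a family such that for each $h\in H$, $\{\Lambda_\omega h\}_{\omega\in\Omega}$ is strongly measurable. Let $A,B$ be positive constants. Then $\{\Lambda_\omega\}_{\omega\in\Omega}$ is a $cg$-frame for $H$ with respect to $\{H_\omega\}_{\omega\in\Omega}$ with bounds $A$ and $B$ if and only if there exists a unique $V\in B(H)$ such that $\Lambda_\omega=\Theta_\omega V$ for $\mu$-almost every $\omega\in\Omega$ and $AI\le V^*V\le BI$.
   Context: $H$ is a separable Hilbert space, $(\Omega,\mu)$ is a measure space with positive measure $\mu$, and $\{H_\omega\}_{\omega\in\Omega}$ is a family of separable Hilbert spaces. $B(H,H_\omega)$ is the space of bounded linear operators from $H$ to $H_\omega$, and $B(H)=B(H,H)$. A $\varphi\in\prod_{\omega\in\Omega}H_\omega$ is strongly measurable if it is measurable as a mapping from $\Omega$ to the direct sum $\oplus_{\omega\in\Omega}H_\omega$. $(\oplus_{\omega\in\Omega}H_\omega,\mu)_{L^2}$ is the Hilbert space of strongly measurable $\varphi$ with $\int_\Omega\|\varphi(\omega)\|^2d\mu(\omega)<\infty$, with inner product $\langle\varphi,\psi\rangle=\int_\Omega\langle\varphi(\omega),\psi(\omega)\rangle d\mu(\omega)$. A family $\{\Lambda_\omega\in B(H,H_\omega)\}_{\omega\in\Omega}$ is a $cg$-frame for $H$ with respect to $\{H_\omega\}_{\omega\in\Omega}$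 with bounds $A,B>0$ if (i) $\{\Lambda_\omega f\}_{\omega\in\Omega}$ is strongly measurable for each $f\in H$, and (ii) $A\|f\|^2\le\int_\Omega\|\Lambda_\omega f\|^2d\mu(\omega)\le B\|f\|^2$ for all $f\in H$. A family $\{\Lambda_\omega\in B(H,H_\omega)\}_{\omega\in\Omega}$ is a $cg$-orthonormal basis for $H$ with respect to $\{H_\omega\}_{\omega\in\Omega}$ if (i) for each $h\in H$, $\{\Lambda_\omega h\}_{\omega\in\Omega}$ is strongly measurable; (ii) for almost all $\nu\in\Omega$, $\int_\Omega\langle\Lambda_\omega^*f_\omega,\Lambda_\nu^*g_\nu\rangle d\mu(\omega)=\langle f_\nu,g_\nu\rangle$ for all $\{f_\omega\}_{\omega\in\Omega}\in(\oplus_{\omega\in\Omega}H_\omega,\mu)_{L^2}$ and $g_\nu\in H_\nu$; (iii) for each $h\in H$, $\int_\Omega\|\Lambda_\omega h\|^2d\mu(\omega)=\|h\|^2$. *)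

(* Defs.v *)
From HB Require Import structures.
From mathcomp Require Import all_boot all_order all_algebra.
From mathcomp Require Import complex.
From mathcomp Require Import all_classical all_reals all_analysis.

Set Implicit Arguments.
Unset Strict Implicit.
Unset Printing Implicit Defensive.

Import Order.TTheory GRing.Theory Num.Theory.
Import numFieldNormedType.Exports.

Local Open Scope classical_set_scope.
Local Open Scope complex_scope.
Local Open Scope ring_scope.

(* Scalars are complex; as everywhere for mathcomp's sesquilinear forms, the
   inner product is linear in its first argument and conjugate-linear in its
   second one.  Separability is not part of the structure. *)
HB.mixin Record isHilbert (R : realType) H & CompleteNormedModule R[i] H := {
  inner : {dot H for Num.conj} ;
  sqr_normE : forall x : H, `|x| ^+ 2 = inner x x }.

#[short(type="hilbertType")]
HB.structure Definition Hilbert (R : realType) :=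
  {H of CompleteNormedModule R[i] H & isHilbert R H}.

Notation "''[<' x , y >]" := (inner x y)
  (at level 0, x at level 99, y at level 99) : ring_scope.

Definition separable (T : topologicalType) :=
  exists2 D : set T, countable D & dense D.

(* The library norm of a normed space over R[i] is R[i]-valued (with real
   nonnegative values). *)
Definition normR (R : realType) (H : hilbertType R) (x : H) : R :=
  complex.Re `|x|.

Section bounded_operators.
Variables (R : realType) (H K : hilbertType R).

Record bounded_op := BoundedOp {
  op :> {linear H -> K} ;
  op_bounded : exists M : R, forall x, normR (op x) <= M * normR x }.

Lemma bounded_op_ext (S T : bounded_op) : S =1 T -> S = T.
Proof.
case: S T => [[S [[Sa] [Sl]]] Sb] [[T [[Ta] [Tl]]] Tb] /= /funext ST.
by subst T; rewrite (Prop_irrelevance Sa Ta) (Prop_irrelevance Sl Tl)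
  in Sb Tb *; congr BoundedOp; exact: Prop_irrelevance.
Qed.

(* The unique z with <T x, y> = <x, z> for all x, which exists for bounded T
   by the Riesz representation theorem. *)
Definition adjoint (T : bounded_op) (y : K) : H :=
  xget 0 [set z : H | forall x : H, '[< T x, y >] = '[< x, z >] ].

End bounded_operators.

Notation "''B' ( H , K )" := (bounded_op H K) (at level 8) : type_scope.

Section operator_order.
Variables (R : realType) (H : hilbertType R).

Definition positive_op (T : H -> H) := forall f : H, 0 <= '[< T f, f >].

Definition op_le (S T : H -> H) := positive_op (fun f => T f - S f).

End operator_order.

Section direct_sum.
Variables (R : realType) (I : choiceType) (H_ : I -> hilbertType R).
Implicit Types x y : forall i, H_ i.

Definition sqnorm_sum x : \bar R :=
  (\esum_(i in [set: I]) (normR (x i) ^+ 2)%:E)%E.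

(* The Hilbert (square-summable) direct sum of the spaces H_ i. *)
Record dsum := DSum {
  dsum_val :> forall i, H_ i ;
  dsum_summable : (sqnorm_sum dsum_val < +oo)%E }.

(* Open sets for the metric given by the norm of the direct sum, that is, the
   square root of sqnorm_sum. *)
Definition dsum_open : set (set dsum) :=
  [set U : set dsum | forall x : dsum, U x -> exists2 e : R, 0 < e &
     forall y : dsum, (sqnorm_sum (fun i => y i - x i)%R < (e ^+ 2)%:E)%E -> U y].

Lemma sqnorm_sum_single i (v : H_ i) :
  (sqnorm_sum (eqtype.dfwith (fun j => 0%R : H_ j) v) < +oo)%E.
Proof.
rewrite /sqnorm_sum.
rewrite (_ : (\esum_(j in _) _)%E = (\esum_(j in [set i])
    (normR (eqtype.dfwith (fun j => 0%R : H_ j) v j) ^+ 2)%:E)%E); last first.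
  rewrite [RHS]esum_mkcond; apply: eq_esum => j _.
  case: ifPn => // /negP; rewrite inE /= => ji.
  rewrite dfwith_out ?/normR ?normr0 /= ?expr0n//.
  by apply/eqP => ij; apply: ji.
by rewrite esum_set1 ?ltry// lee_fin sqr_ge0.
Qed.

(* The canonical copy of H_ i in the direct sum. *)
Definition dsum_single i (v : H_ i) : dsum := DSum (sqnorm_sum_single v).

Lemma sqnorm_sum0 : (sqnorm_sum (fun j => 0%R : H_ j) < +oo)%E.
Proof.
rewrite /sqnorm_sum esum1 ?ltry// => i _.
by rewrite /normR normr0 /= expr0n.
Qed.

HB.instance Definition _ := gen_eqMixin dsum.
HB.instance Definition _ := gen_choiceMixin dsum.
HB.instance Definition _ := isPointed.Build dsum (DSum sqnorm_sum0).

End direct_sum.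

Section cg.
Variables (R : realType) (d : measure_display) (Omega : measurableType d).
Variable mu : {measure set Omega -> \bar R}.
Variable H_ : Omega -> hilbertType R.

(* Measurability of phi as a mapping from Omega to the Hilbert direct sum, the
   value phi w being identified with its copy in the direct sum and the direct
   sum being equipped with its Borel sigma-algebra. *)
Definition strongly_measurable (phi : forall w, H_ w) :=
  measurable_fun [set: Omega]
    (fun w => dsum_single (phi w) : g_sigma_algebraType (@dsum_open R Omega H_)).

Definition sqnorm_int (phi : forall w, H_ w) : \bar R :=
  (\int[mu]_w (normR (phi w) ^+ 2)%:E)%E.

Definition in_L2 (phi : forall w, H_ w) :=
  strongly_measurable phi /\ (sqnorm_int phi < +oo)%E.

Definition cintegral (F : Omega -> R[i]) : R[i] :=
  (\int[mu]_w complex.Re (F w)) +i* (\int[mu]_w complex.Im (F w)).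

Variable H : hilbertType R.

Definition cg_frame (Lam : forall w, 'B(H, H_ w)) (A B : R) :=
  [/\ 0 < A, 0 < B,
      forall f : H, strongly_measurable (fun w => Lam w f) &
      forall f : H, ((A * normR f ^+ 2)%:E <= sqnorm_int (fun w => Lam w f))%E /\
                    (sqnorm_int (fun w => Lam w f) <= (B * normR f ^+ 2)%:E)%E].

(* The integrand of the second condition is integrable as soon as the two
   other conditions hold, since it is equal to <f w, Theta w h> for a fixed
   vector h. *)
Definition cg_orthonormal_basis (Theta : forall w, 'B(H, H_ w)) :=
  [/\ forall h : H, strongly_measurable (fun w => Theta w h),
      {ae mu, forall nu, forall (f : forall w, H_ w) (g : H_ nu), in_L2 f ->
        cintegral (fun w => '[< adjoint (Theta w) (f w), adjoint (Theta nu) g >])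
        = '[< f nu, g >]} &
      forall h : H, sqnorm_int (fun w => Theta w h) = (normR h ^+ 2)%:E].

End cg.

(* Main.v *)
Require Import Defs.
From HB Require Import structures.
From mathcomp Require Import all_boot all_order all_algebra.
From mathcomp Require Import complex.
From mathcomp Require Import all_classical all_reals all_analysis.
From mathcomp Require Import measurable_realfun ring lra.
Set Implicit Arguments.
Unset Strict Implicit.
Unset Printing Implicit Defensive.
Import Order.TTheory GRing.Theory Num.Theory.
Import numFieldNormedType.Exports.
Local Open Scope classical_set_scope.
Local Open Scope complex_scope.
Local Open Scope ring_scope.

(* The operator V is the weak integral V f = \int Theta_w^* (Lam_w f) dmu(w),
   given by the Riesz representation theorem.  The second condition on Theta,
   applied to the square-integrable family (Lam_w f), gives Theta_w (V f) =
   Lam_w f for almost every w.  The third condition says that h |-> (Theta_w h)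
   is isometric, so V is determined by this equation (hence unique and linear),
   and |V f|^2 is the integral of |Lam_w f|^2, which turns the frame bounds into
   the bounds on V^* V.  Only real parts of inner products are integrated: they
   determine the vectors involved. *)

(** The quadratic is tested at its minimizer [- b / c]; when [c = 0] it is affine, and nonnegativity
    forces [b = 0]. *)
Lemma discriminant_le (R : realFieldType) (a b c : R) : 0 <= c ->
  (forall t, 0 <= a + 2 * t * b + t ^+ 2 * c) -> b ^+ 2 <= a * c.
Proof.
rewrite le_eqVlt => /predU1P[<- h|c_gt0 h].
  have [->|b_neq0] := eqVneq b 0; first by rewrite expr0n mulr0.
  (* At this point the affine function takes the value [-1]. *)
  have := h (- (a + 1) / (2 * b)).
  rewrite (_ : _ + _ = -1); last by field.
  by rewrite ler0N1.
have := h (- b / c); rewrite (_ : _ + _ = (a * c - b ^+ 2) / c); last first.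
  by field; rewrite gt_eqF.
by rewrite pmulr_lge0 ?invr_gt0// subr_ge0.
Qed.

(** * The underlying real inner product *)

Section rdot.
Variables (R : realType) (H : hilbertType R).
Implicit Types x y z : H.

Definition rdot x y : R := complex.Re '[< x, y >].

Lemma rdotDl x y z : rdot (x + y) z = rdot x z + rdot y z.
Proof. by rewrite /rdot linearDl raddfD. Qed.

Lemma rdotNl x y : rdot (- x) y = - rdot x y.
Proof. by rewrite /rdot linearNl raddfN. Qed.

Lemma rdotBl x y z : rdot (x - y) z = rdot x z - rdot y z.
Proof. by rewrite rdotDl rdotNl. Qed.

Lemma rdotZl (a : R) x y : rdot (a%:C *: x) y = a * rdot x y.
Proof.
rewrite /rdot linearZl_LR /=.
by case: ('[< x, y >]) => b c /=; rewrite mul0r subr0.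
Qed.

Lemma innerC x y : '[< x, y >] = ('[< y, x >])^*.
Proof.
by rewrite (hermC (inner : {hermitian H for false & Num.conj})) /= mul1r.
Qed.

Lemma rdotC x y : rdot x y = rdot y x.
Proof. by rewrite /rdot innerC; case: ('[< y, x >]). Qed.

Lemma rdotDr x y z : rdot x (y + z) = rdot x y + rdot x z.
Proof. by rewrite rdotC rdotDl !(rdotC x). Qed.

Lemma rdotBr x y z : rdot x (y - z) = rdot x y - rdot x z.
Proof. by rewrite rdotC rdotBl !(rdotC x). Qed.

Lemma rdotZr (a : R) x y : rdot x (a%:C *: y) = a * rdot x y.
Proof. by rewrite rdotC rdotZl rdotC. Qed.

Lemma normrE x : `|x| = (normR x)%:C.
Proof. by rewrite RRe_real// ger0_real. Qed.

Lemma normR_ge0 x : 0 <= normR x.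
Proof. by rewrite -ler0c -normrE. Qed.

Lemma normR0 : normR (0 : H) = 0.
Proof. by rewrite /normR normr0. Qed.

Lemma normR_eq0 x : normR x = 0 -> x = 0.
Proof. by move=> x0; apply/eqP; rewrite -normr_eq0 normrE x0. Qed.

Lemma innerxx x : '[< x, x >] = (normR x ^+ 2)%:C.
Proof. by rewrite -sqr_normE normrE rmorphXn. Qed.

Lemma rdotxx x : rdot x x = normR x ^+ 2.
Proof. by rewrite /rdot innerxx. Qed.

Lemma rdot_inj x y : (forall z, rdot x z = rdot y z) -> x = y.
Proof.
move=> xy; apply/eqP; rewrite -subr_eq0; apply/eqP/normR_eq0/eqP.
by rewrite -sqrf_eq0 -rdotxx rdotBl xy subrr.
Qed.

Lemma sqr_normRD x y :
  normR (x + y) ^+ 2 = normR x ^+ 2 + 2 * rdot x y + normR y ^+ 2.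
Proof. by rewrite -!rdotxx rdotDl !rdotDr (rdotC y x); ring. Qed.

Lemma rdot_cs x y : `|rdot x y| <= normR x * normR y.
Proof.
rewrite -(@ler_pXn2r _ 2)// ?nnegrE ?mulr_ge0 ?normR_ge0//.
rewrite real_normK ?num_real// exprMn; apply: discriminant_le.
  exact: sqr_ge0.
move=> t; apply: (@le_trans _ _ (normR (x + t%:C *: y) ^+ 2)).
  exact: sqr_ge0.
by rewrite -!rdotxx rdotDl !rdotDr !(rdotZl, rdotZr) (rdotC y x); nra.
Qed.

Lemma rdot_amgm x y : 2 * `|rdot x y| <= normR x ^+ 2 + normR y ^+ 2.
Proof.
have := rdot_cs x y; have := sqr_ge0 (normR x - normR y); nra.
Qed.

Lemma ballR_normR x y (e : R) : ball x e%:C y <-> normR (x - y) < e.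
Proof. by rewrite -ball_normE /ball_ /= normrE ltcR. Qed.

End rdot.

(** * Riesz representation of real-linear functionals *)

Section riesz.
Variables (R : realType) (H : hilbertType R) (l : H -> R) (c : R).
Hypothesis lD : forall x y, l (x + y) = l x + l y.
Hypothesis lZ : forall (a : R) x, l (a%:C *: x) = a * l x.
Hypothesis l_le : forall x, 2 * l x <= normR x ^+ 2 + c.

(* The representing vector is the limit of the minimizing filter of
   |x|^2 - 2 l x, which [l_le] bounds from below; the filter is Cauchy by the
   parallelogram identity. *)
Lemma riesz : exists z, forall x, l x = rdot x z.
Proof.
pose q x := normR x ^+ 2 - 2 * l x.
have q_inf : has_inf (range q).
  split; first by exists (q 0), 0.
  by exists (- c) => _ [x _ <-]; have := l_le x; rewrite /q; lra.
pose m := inf (range q).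
have m_le x : m <= q x by apply: (inf_lbound q_inf.2); exists x.
have parallelogram x y : normR (x - y) ^+ 2 <= 2 * (q x + q y - 2 * m).
  (* At the midpoint of [x] and [y], [q] is still at least [m]. *)
  have := m_le ((2^-1)%:C *: (x + y)).
  rewrite /q lZ lD -!rdotxx rdotZl rdotZr rdotBl !rdotBr rdotDl !rdotDr.
  by rewrite (rdotC y x); lra.
pose S e := [set x | q x < m + e].
pose F := filter_from [set e : R | 0 < e] S.
have FF : ProperFilter F.
  apply: filter_from_proper; last first.
    move=> e e_gt0; have [_ [x _ <-] qx] := inf_adherent e_gt0 q_inf.
    by exists x.
  apply: filter_from_filter; first by exists 1 => /=.
  move=> e e' /= e_gt0 e'_gt0; exists (Num.min e e').
    by rewrite /= lt_min e_gt0.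
  move=> x; rewrite /S /= => qx.
  by split; apply: (lt_le_trans qx); rewrite lerD2l ge_min lexx ?orbT.
have /cauchy_cvgP/cvg_ex[z Fz] : cauchy F.
  (* Radii of balls live in [R[i]]; a positive one is real. *)
  apply: cauchy_exP => e; rewrite ltcE => /= /andP[/eqP e_im e_gt0].
  have -> : e = (complex.Re e)%:C by case: e e_im {e_gt0} => a b /= ->.
  move: (complex.Re e) e_gt0 => r r_gt0.
  (* By [parallelogram], two points where [q < m + d] are at squared distance less than [4 * d]. *)
  have d_gt0 : 0 < r ^+ 2 / 4 by rewrite divr_gt0 ?exprn_gt0.
  have [x Sx] := filter_ex (@in_filter_from _ _ _ S _ d_gt0 : F (S (r ^+ 2 / 4))).
  exists x, (r ^+ 2 / 4) => // y Sy; apply/ballR_normR.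
  rewrite -(@ltr_pXn2r _ 2)// ?nnegrE ?normR_ge0 ?ltW//.
  by have := parallelogram x y; move: Sx Sy; rewrite /S /=; lra.
exists z => x; apply/eqP; rewrite eq_sym -subr_eq0 -normr_le0.
apply/ler_addgt0Pr => e e_gt0; rewrite add0r.
have [x0|x_gt0] := leP (normR x) 0.
  have -> : x = 0 by apply: normR_eq0; apply/eqP; rewrite eq_le x0 normR_ge0.
  have := lZ 0 0; rewrite scaler0 mul0r => ->.
  by have := rdotZl 0 0 z; rewrite scaler0 mul0r => ->; rewrite subrr normr0 ltW.
(* [t * normR x] is half of [e]: one half pays for [y] not being an exact minimizer, the other for
   its distance to [z]. *)
pose t := e / (2 * normR x).
have t_gt0 : 0 < t by rewrite divr_gt0 ?mulr_gt0.
have [y [Sy zy]] : exists y, S (t ^+ 2) y /\ normR (z - y) < t.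
  have t2 : 0 < t ^+ 2 by rewrite exprn_gt0.
  have FB : F (ball z t%:C) by apply: Fz; apply: nbhsx_ballx; rewrite ltcR.
  have [y [? /ballR_normR ?]] :=
    filter_ex (filterI (@in_filter_from _ _ _ S _ t2 : F (S (t ^+ 2))) FB).
  by exists y.
(* Since [q (y + s x) >= m > q y - t ^+ 2] for all real [s], the discriminant bounds the derivative
   of [q] at [y] in the direction [x]. *)
have near_min : `|rdot x y - l x| <= t * normR x.
  rewrite -(@ler_pXn2r _ 2)// ?nnegrE ?normR_ge0//; last first.
    exact: mulr_ge0 (ltW t_gt0) (normR_ge0 x).
  rewrite real_normK ?num_real// exprMn; apply: discriminant_le.
    exact: sqr_ge0.
  move=> s; have := m_le (y + s%:C *: x); move: Sy.
  rewrite /S /= /q lD lZ -!rdotxx rdotDl !rdotDr !(rdotZl, rdotZr) (rdotC y x).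
  by lra.
have near_lim : `|rdot x z - rdot x y| <= t * normR x.
  rewrite -rdotBr; apply: le_trans (rdot_cs _ _) _.
  by rewrite mulrC ler_wpM2r ?normR_ge0 ?ltW.
have -> : e = t * normR x + t * normR x.
  by rewrite /t; field; rewrite gt_eqF.
have -> : rdot x z - l x = (rdot x z - rdot x y) + (rdot x y - l x) by ring.
by apply: le_trans (ler_normD _ _) _; rewrite lerD.
Qed.

End riesz.

(** * Adjoints and construction of bounded operators *)

Section adjoint.
Variables (R : realType) (H K : hilbertType R).

(** Evaluating the real identity at [- 'i *: x] yields the imaginary parts at [x]. *)
Lemma inner_ext (T : {linear H -> K}) (y : K) (z : H) :
  (forall x, rdot (T x) y = rdot x z) ->
  forall x, '[< T x, y >] = '[< x, z >].
Proof.
move=> Tz x; have := Tz x; have := Tz (- 'i *: x).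
rewrite /rdot linearZ/= !linearZl_LR/=.
case: ('[< T x, y >]) => a b; case: ('[< x, z >]) => a' b' /=.
by rewrite oppr0 !mul0r !mulN1r !sub0r !opprK => -> ->.
Qed.

(** [adjoint] defaults to 0 when no representing vector exists; the Riesz lemma rules this out. *)
Lemma adjointE (T : 'B(H, K)) x y : '[< T x, y >] = '[< x, adjoint T y >].
Proof.
suff [z Tz] : exists z, forall x, '[< T x, y >] = '[< x, z >].
  by move: x; apply: (@xgetPex _ 0 [set z | forall x, '[< T x, y >] = '[< x, z >]]);
    exists z.
have [M TM] := op_bounded T.
(* The constant comes from [2 M |w| |y| <= |w|^2 + (M |y|)^2]. *)
have [||w|z Tz] := @riesz R H (fun x => rdot (T x) y) ((M * normR y) ^+ 2).
- by move=> u v; rewrite linearD rdotDl.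
- by move=> a u; rewrite linearZ rdotZl.
- have TMy : rdot (T w) y <= M * normR w * normR y.
    apply: le_trans (ler_norm _) (le_trans (rdot_cs _ _) _).
    by rewrite ler_wpM2r ?normR_ge0.
  by have := sqr_ge0 (normR w - M * normR y); nra.
- by exists z; exact: inner_ext.
Qed.

Lemma rdot_adjointl (T : 'B(H, K)) x y : rdot (adjoint T y) x = rdot y (T x).
Proof. by rewrite rdotC /rdot -adjointE -/(rdot _ _) rdotC. Qed.

Lemma bounded_opE (V : H -> K) (M : R) : linear V ->
  (forall x, normR (V x) <= M * normR x) -> exists T : 'B(H, K), T =1 V.
Proof.
move=> Vlin VM.
pose V' : {linear H -> K} := HB.pack V (GRing.isLinear.Build _ _ _ _ V Vlin).
by exists (@BoundedOp _ _ _ V' (ex_intro _ M VM)).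
Qed.

End adjoint.

(** * Operator inequalities as norm inequalities *)

Section operator_bounds.
Variables (R : realType) (H : hilbertType R) (V : 'B(H, H)).

Lemma inner_adjointK f : '[< adjoint V (V f), f >] = (normR (V f) ^+ 2)%:C.
Proof. by rewrite innerC -adjointE -innerC innerxx. Qed.

Lemma inner_scale (a : R) (f : H) :
  '[< a%:C *: f, f >] = (a * normR f ^+ 2)%:C.
Proof. by rewrite linearZl_LR/= innerxx -rmorphM. Qed.

Lemma op_le_scalel (a : R) : op_le (fun f => a%:C *: f) (adjoint V \o V) <->
  forall f, a * normR f ^+ 2 <= normR (V f) ^+ 2.
Proof.
by split=> + f => /(_ f); rewrite /= linearBl/= inner_adjointK inner_scale
  -rmorphB/= ler0c subr_ge0.
Qed.

Lemma op_le_scaler (b : R) : op_le (adjoint V \o V) (fun f => b%:C *: f) <->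
  forall f, normR (V f) ^+ 2 <= b * normR f ^+ 2.
Proof.
by split=> + f => /(_ f); rewrite /= linearBl/= inner_adjointK inner_scale
  -rmorphB/= ler0c subr_ge0.
Qed.

End operator_bounds.

(** * Measurability and integrability of families of vectors *)

Section square_integrable.
Variables (R : realType) (d : measure_display) (Omega : measurableType d).
Variables (mu : {measure set Omega -> \bar R}) (H_ : Omega -> hilbertType R).
Implicit Types phi psi : forall w, H_ w.

(* The copies of H_ w and H_ w' in the direct sum meet only at 0, so that every
   set of nonzero values of [phi] is cut out of its range by an open set. *)
Lemma strongly_measurable_sub phi (S : set Omega) : strongly_measurable phi ->
  (forall w, S w -> phi w != 0) -> measurable S.
Proof.
move=> phim S_neq0.
pose U : set (dsum H_) := [set x | exists2 w, S w & x w != 0].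
(* The radius [normR (x w)] works: a [y] vanishing at [w] is at least that far from [x]. *)
have U_open : dsum_open U.
  move=> x [w Sw xw]; exists (normR (x w)).
    by rewrite lt_def normR_ge0 andbT; apply: contra_neq xw; exact: normR_eq0.
  move=> y xy; exists w => //; apply: contraPneq xy => yw0; apply/negP.
  rewrite -leNgt /sqnorm_sum.
  apply: esum_ge; exists [set w]; first by split=> //; exact: finite_set1.
  by rewrite fsbig_set1 lee_fin yw0 sub0r /normR normrN.
have := phim measurableT U (@sub_sigma_algebra _ setT _ _ U_open).
congr measurable; rewrite setTI; apply/seteqP; split=> [w [v Sv]|w Sw] /=.
  have [->//|wv] := eqVneq w v.
  by rewrite dfwith_out ?eqxx.
by exists w => //=; rewrite dfwith_in; exact: S_neq0.
Qed.

(** The preimage of [Y], or its complement when [Y] contains 0, lies where [phi] is nonzero, hence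
    is measurable. Integrands below get their measurability this way. *)
Lemma strongly_measurable_comp phi (F : Omega -> R) : strongly_measurable phi ->
  (forall w, phi w = 0 -> F w = 0) -> measurable_fun setT F.
Proof.
move=> phim F0 _ Y _; rewrite setTI.
have F_neq0 w : F w <> 0 -> phi w != 0 by apply: contra_notN => /eqP/F0.
have [Y0|Y0] := pselect (Y 0).
  rewrite -[X in measurable X]setCK; apply: measurableC.
  apply: (strongly_measurable_sub phim) => w /= nYF; apply: F_neq0 => Fw.
  by rewrite Fw in nYF.
apply: (strongly_measurable_sub phim) => w /= YF; apply: F_neq0 => Fw.
by rewrite Fw in YF.
Qed.

Lemma measurable_sqnormR phi : strongly_measurable phi ->
  measurable_fun setT (fun w => normR (phi w) ^+ 2 : R).
Proof.
move=> phim; apply: (strongly_measurable_comp phim).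
by move=> w ->; rewrite normR0 expr0n.
Qed.

Lemma sqnormR_integrable phi : in_L2 mu phi ->
  mu.-integrable setT (fun w => (normR (phi w) ^+ 2)%:E).
Proof.
move=> [phim phi_fin]; apply/integrableP; split.
  exact/measurable_EFinP/measurable_sqnormR.
by under eq_integral do rewrite gee0_abs ?lee_fin ?sqr_ge0//.
Qed.

Lemma rdot_integrable phi psi : in_L2 mu phi -> in_L2 mu psi ->
  mu.-integrable setT (EFin \o (fun w => rdot (phi w) (psi w))).
Proof.
move=> phi2 psi2.
apply: (@le_integrable _ _ _ _ _ measurableT _
  ((fun w => (normR (phi w) ^+ 2)%:E) \+ (fun w => (normR (psi w) ^+ 2)%:E))%E).
- apply/measurable_EFinP; apply: (strongly_measurable_comp phi2.1) => w ->.
  by rewrite /rdot linear0l.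
- move=> w _ /=; rewrite lee_fin [leRHS]ger0_norm ?addr_ge0 ?sqr_ge0//.
  have := rdot_amgm (phi w) (psi w).
  by have := normr_ge0 (rdot (phi w) (psi w)); lra.
- by apply: integrableD => //; exact: sqnormR_integrable.
Qed.

Lemma eq_sqnorm_int phi psi : strongly_measurable phi ->
  strongly_measurable psi -> {ae mu, forall w, phi w = psi w} ->
  sqnorm_int mu phi = sqnorm_int mu psi.
Proof.
move=> phim psim phipsi; apply: ge0_ae_eq_integral => //.
- exact/measurable_EFinP/measurable_sqnormR.
- exact/measurable_EFinP/measurable_sqnormR.
- by move=> w _; rewrite lee_fin sqr_ge0.
- by move=> w _; rewrite lee_fin sqr_ge0.
- by apply: filterS phipsi => w /= ->.
Qed.

End square_integrable.

(** * Analysis and synthesis for a cg-orthonormal basis *)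

Section orthonormal_basis.
Variables (R : realType) (d : measure_display) (Omega : measurableType d).
Variables (mu : {measure set Omega -> \bar R}) (H_ : Omega -> hilbertType R).
Variables (H : hilbertType R) (Theta : forall w, 'B(H, H_ w)).
Hypothesis Theta_onb : cg_orthonormal_basis mu Theta.

Lemma onb_in_L2 h : in_L2 mu (fun w => Theta w h).
Proof. by have [Thm _ Thn] := Theta_onb; split; rewrite // Thn ltry. Qed.

Lemma onb_inj x y : {ae mu, forall w, Theta w x = Theta w y} -> x = y.
Proof.
move=> xy; have [Thm _ Thn] := Theta_onb.
apply/eqP; rewrite -subr_eq0; apply/eqP/normR_eq0/eqP.
rewrite -sqrf_eq0 -eqe -Thn.
rewrite (@eq_sqnorm_int _ _ _ _ _ _ (fun w => Theta w 0))//.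
  by rewrite Thn normR0 expr0n.
by apply: filterS xy => w; rewrite linearB linear0 => ->; rewrite subrr.
Qed.

Lemma onb_weak_integral phi : in_L2 mu phi ->
  exists z, forall h, \int[mu]_w rdot (Theta w h) (phi w) = rdot h z.
Proof.
move=> phi2; have [_ _ Thn] := Theta_onb.
(* The lower bound needed by [riesz] is [rdot_amgm] integrated, with the squared [L^2] norm of [phi]
   as constant. *)
apply: (@riesz _ _ _ (fine (sqnorm_int mu phi))) => [x y|a x|x].
- rewrite -RintegralD//; first by under eq_Rintegral do rewrite linearD rdotDl.
  + exact: (rdot_integrable (onb_in_L2 x) phi2).
  + exact: (rdot_integrable (onb_in_L2 y) phi2).
- rewrite -RintegralZl//; first by under eq_Rintegral do rewrite linearZ rdotZl.
  exact: (rdot_integrable (onb_in_L2 x) phi2).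
- have Th2 := sqnormR_integrable (onb_in_L2 x).
  have ph2 := sqnormR_integrable phi2.
  have dot := rdot_integrable (onb_in_L2 x) phi2.
  have -> : normR x ^+ 2 = \int[mu]_w (normR (Theta w x) ^+ 2).
    by rewrite /Rintegral -/(sqnorm_int mu (fun w => Theta w x)) Thn.
  rewrite -[fine _]/(\int[mu]_w (normR (phi w) ^+ 2)).
  rewrite -RintegralD// -RintegralZl//; apply: le_Rintegral => //.
  + have : mu.-integrable setT (fun w => 2%:E * (rdot (Theta w x) (phi w))%:E)%E.
      exact: integrableZl dot.
    exact: eq_integrable.
  + exact: (@integrableD _ _ _ _ _ measurableT _ _ Th2 ph2).
  + move=> w _; apply: le_trans (rdot_amgm _ _).
    by rewrite ler_pM2l// ler_norm.
Qed.

(** One null set serves all [phi], so that later it serves all vectors [f] at once. [S] merely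
    chooses weak integrals; its values off [L^2] are arbitrary. *)
Lemma onb_synthesis : exists S : (forall w, H_ w) -> H,
  {ae mu, forall nu, forall phi, in_L2 mu phi -> Theta nu (S phi) = phi nu}.
Proof.
have [_ Thi _] := Theta_onb.
have /choice[S SP] phi : exists z, in_L2 mu phi ->
    forall h, \int[mu]_w rdot (Theta w h) (phi w) = rdot h z.
  have [/onb_weak_integral[z zP]|nphi] := pselect (in_L2 mu phi).
    by exists z.
  by exists 0.
exists S; apply: filterS Thi => nu Thi phi phi2; apply: rdot_inj => g.
(* Both sides become the weak integral of [phi] tested against [adjoint (Theta nu) g]. *)
apply: etrans (congr1 (@complex.Re R) (Thi phi g phi2)).
rewrite /= rdotC -rdot_adjointl -(SP _ phi2); apply: eq_Rintegral => w _.
by rewrite -/(rdot _ _) rdot_adjointl rdotC.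
Qed.

End orthonormal_basis.

Theorem theorem2p6 (R : realType) (d : measure_display)
  (Omega : measurableType d) (mu : {measure set Omega -> \bar R})
  (H : hilbertType R) (H_ : Omega -> hilbertType R)
  (sepH : separable H) (sepH_ : forall w, separable (H_ w))
  (Theta Lam : forall w, 'B(H, H_ w))
  (Theta_onb : cg_orthonormal_basis mu Theta)
  (Lam_meas : forall h : H, strongly_measurable (fun w => Lam w h))
  (A B : R) (A_gt0 : 0 < A) (B_gt0 : 0 < B) :
  cg_frame mu Lam A B <->
  exists! V : 'B(H, H),
    {ae mu, forall w, Lam w =1 Theta w \o V} /\
    (op_le (fun f => A%:C *: f) (adjoint V \o V) /\
     op_le (adjoint V \o V) (fun f => B%:C *: f)).
Proof.
have [Thm _ Thn] := Theta_onb.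
(* [V] is a bare function here, because the identity also serves to prove the chosen [V] bounded. *)
have sqnorm_Lam (V : H -> H) f :
    {ae mu, forall w, forall f, Theta w (V f) = Lam w f} ->
    sqnorm_int mu (fun w => Lam w f) = (normR (V f) ^+ 2)%:E.
  move=> LamV; rewrite -Thn; apply: eq_sqnorm_int => //.
  by apply: filterS LamV => w ->.
split=> [[_ _ _ frame]|[V [[LamV []]]]]; last first.
  move=> /op_le_scalel AV /op_le_scaler VB _; split=> // f.
  rewrite (sqnorm_Lam V) ?lee_fin//.
  by apply: filterS LamV => w Lw g; rewrite Lw.
have Lam2 f : in_L2 mu (fun w => Lam w f).
  by split=> //; apply: le_lt_trans (frame f).2 (ltry _).
have [S SP] := onb_synthesis Theta_onb.
pose V f := S (fun w => Lam w f).
have LamV : {ae mu, forall w, forall f, Theta w (V f) = Lam w f}.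
  by apply: filterS SP => w Sw f; rewrite Sw.
(* [S] was obtained by choice, so linearity is recovered from the injectivity of the analysis
   map. *)
have V_lin : linear V.
  move=> a f g; apply: (onb_inj Theta_onb); apply: filterS LamV => w Lw.
  by rewrite linearP !Lw linearP.
have V_bnd f : normR (V f) <= Num.sqrt B * normR f.
  rewrite -(@ler_pXn2r _ 2)// ?nnegrE ?mulr_ge0 ?sqrtr_ge0 ?normR_ge0//.
  rewrite exprMn sqr_sqrtr ?(ltW B_gt0)// -lee_fin -(sqnorm_Lam V)//.
  exact: (frame f).2.
have [T TV] := bounded_opE V_lin V_bnd.
exists T; split.
  split; first by apply: filterS LamV => w Lw f; rewrite /= TV Lw.
  split; [apply/op_le_scalel|apply/op_le_scaler] => f;
    rewrite TV -lee_fin -(sqnorm_Lam V)//; apply (frame f).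
move=> T' [LamT' _]; apply: bounded_op_ext => f; rewrite TV.
apply: (onb_inj Theta_onb); apply: filterS2 LamV LamT' => w Lw Lw'.
by rewrite Lw Lw'.
Qed.
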